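(* Let $\{a_n\}_{n\ge1}$ be a sequence of positive real numbers such that $\lim_{n\to\infty}na_n$ exists, is finite and nonzero, let $r=\{r_n\}_{n\ge1}$ and $t=\{t_n\}_{n\ge1}$ be bounded sequences of strictly positive real numbers, and let $s$ be an $s$-number sequence. If $r_n\le t_n$ for all $n$, then $\chi_{c_0(t)}^{(s)}\subseteq\chi_{c_0(r)}^{(s)}$.
   Context: $\mathbb{N}=\{1,2,\dots\}$. $\mathcal{B}$ is the class of all bounded linear operators between arbitrary Banach spaces, with components $\mathcal{B}(X,Y)$. An $s$-number sequence is a map $s:\mathcal{B}\to\mathbb{R}^{\mathbb{N}}$ assigning to each $\phi\in\mathcal{B}$ a non-negative sequence $\{s_n(\phi)\}$ with: (1) $\|\phi\|=s_1(\phi)\ge s_2(\phi)\ge\cdots\ge0$; (2) $s_{m+n-1}(\phi+\psi)\le s_m(\phi)+s_n(\psi)$ for $\phi,\psi\in\mathcal{B}(X,Y)$; (3) $s_n(\zeta\phi\eta)\le\|\zeta\|s_n(\phi)\|\eta\|$ for $\eta\in\mathcal{B}(X_0,X)$, $\phi\in\mathcal{B}(X,Y)$, $\zeta\in\mathcal{B}(Y,Y_0)$; (4) $s_n(\phi)=0$ if $\operatorname{rank}(\phi)<n$; (5) $s_n(I:\ell_2^{(n)}\to\ell_2^{(n)})=1$, where $I$ is the identity operator on the $n$-dimensional Hilbert space $\ell_2^{(n)}$. For a weight $r$, the class of operators $\chi_{c_0(r)}^{(s)}$ is $$\chi_{c_0(r)}^{(s)}=\Big\{\phi\in\mathcal{B}:\lim_{i\to\infty}\Big(a_i\sum_{j=1}^is_j(\phi)\Big)r_i=0\Big\},$$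 and $\chi_{c_0(t)}^{(s)}$ is defined likewise with $t$ in place of $r$. *)

(* Defs.v *)
From HB Require Import structures.
From mathcomp Require Import all_boot all_order all_algebra.
From mathcomp Require Import all_classical all_reals all_analysis.
From mathcomp Require Import complex ring lra.

Set Implicit Arguments.
Unset Strict Implicit.
Unset Printing Implicit Defensive.

Import Order.TTheory GRing.Theory Num.Theory.
Import numFieldNormedType.Exports.

Local Open Scope classical_set_scope.
Local Open Scope ring_scope.

(* Banach spaces are taken over the real or the complex numbers; everything
   below is uniform in this choice. *)
Inductive scalar_kind := RealScalars | ComplexScalars.

Section Scalars.
Variable (R : realType).

Definition scalar_field (k : scalar_kind) : numFieldType :=
  match k with RealScalars => R | ComplexScalars => R[i] end.

Definition to_real (k : scalar_kind) : scalar_field k -> R :=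
  match k return scalar_field k -> R with
  | RealScalars => id
  | ComplexScalars => @complex.Re R
  end.

Definition of_real (k : scalar_kind) : R -> scalar_field k :=
  match k return R -> scalar_field k with
  | RealScalars => id
  | ComplexScalars => real_complex R
  end.

(* The library's norms over [scalar_field k] are valued in [scalar_field k]:
   this is the real-valued version. *)
Definition rnorm k (X : normedModType (scalar_field k)) (x : X) : R := to_real `|x|.

Variable k : scalar_kind.
Local Notation K := (scalar_field k).

Lemma of_realK : cancel (@of_real k) (@to_real k). Proof. by case: k. Qed.

Lemma to_realK (x : K) : 0 <= x -> of_real k (to_real x) = x.
Proof.
case: k x => //= x x0; have := ger0_Im x0.
by case: x {x0} => x y /= ->.
Qed.

Lemma of_realD : {morph of_real k : x y / x + y}.
Proof. by case: k => //= x y; apply/eqP; rewrite eq_complex/= addr0 !eqxx. Qed.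

Lemma of_realM : {morph of_real k : x y / x * y}.
Proof.
by case: k => //= x y; apply/eqP; rewrite eq_complex/= !mul0r !mulr0 subr0 addr0 !eqxx.
Qed.

Lemma of_real_le (x y : R) : (of_real k x <= of_real k y) = (x <= y).
Proof. by case: k => //=; rewrite lecE /= eqxx. Qed.

Lemma of_real_lt (x y : R) : (of_real k x < of_real k y) = (x < y).
Proof. by case: k => //=; rewrite ltcE /= eqxx. Qed.

Lemma of_real0 : of_real k 0 = 0.
Proof. by case: k. Qed.

Lemma of_real_rnorm (X : normedModType K) (x : X) : of_real k (rnorm x) = `|x|.
Proof. exact: to_realK. Qed.

Lemma rnorm_ge0 (X : normedModType K) (x : X) : 0 <= rnorm x.
Proof. by rewrite -of_real_le of_real_rnorm of_real0. Qed.

Lemma cauchy_image (V W : normedModType K) (f : V -> W) (F : set_system V) :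
  (forall x y, `|f x - f y| <= `|x - y|) ->
  ProperFilter F -> cauchy F -> cauchy (f @ F).
Proof.
move=> fP FF /cauchyP Fc; apply/cauchyP => e e0.
have [x Fx] := Fc _ e0; exists (f x).
suff : F (f @^-1` ball (f x) e) by [].
apply: filterS Fx => y; rewrite /preimage -!ball_normE/=.
exact: le_lt_trans (fP _ _).
Qed.

End Scalars.

Lemma scalar_complete (R : realType) k (F : set_system (scalar_field R k)) :
  ProperFilter F -> cauchy F -> cvg F.
Proof.
case: k F => F FF Fc; first exact: R_complete.
have part (f : R[i] -> R) :
    (forall x y, f x - f y = f (x - y)) -> (forall x, `|f x| <= complex.Re `|x|) ->
    cvg (f @ F).
  move=> fB fle; apply: R_complete; apply/cauchyP => e e0.
  have e0C : 0 < real_complex R e :> R[i] by rewrite ltcR.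
  have [x Fx] := (cauchyP F).1 Fc _ e0C; exists (f x).
  suff : F (f @^-1` ball (f x) e) by [].
  apply: filterS Fx => y; rewrite /preimage -!ball_normE/= fB => xy.
  apply: le_lt_trans (fle _) _.
  by move: xy; rewrite ltcE/= => /andP[_].
have [|x|a /= Fa] := (cvg_ex _).1 (part (@complex.Re R) _ _).
- by case=> [a b] [c d].
- rewrite normc_def /= -sqrtr_sqr ler_wsqrtr// lerDl sqr_ge0//.
have [|x|b /= Fb] := (cvg_ex _).1 (part (@complex.Im R) _ _).
- by case=> [? ?] [? ?].
- rewrite normc_def /= -sqrtr_sqr ler_wsqrtr// lerDr sqr_ge0//.
pose K := scalar_field R ComplexScalars.
suff FK : F --> (Complex a b : K) by exact: cvgP FK.
apply/(@cvgrPdist_le _ K) => e e0.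
have [e1 e2] : complex.Im e = 0 /\ 0 < complex.Re e.
  by move: e0; rewrite ltcE/= => /andP[/eqP].
have e20 : 0 < complex.Re e / 2 by rewrite divr_gt0.
have Ha : F [set z : K | `|a - complex.Re z| <= complex.Re e / 2].
  exact: (cvgrPdist_le _ _).1 Fa _ e20.
have Hb : F [set z : K | `|b - complex.Im z| <= complex.Re e / 2].
  exact: (cvgrPdist_le _ _).1 Fb _ e20.
apply: (@filterS2 K F _ _ _ _ _ Ha Hb) => -[c d] /= ca db.
rewrite (@normc_def R) lecE/= e1 eqxx/=.
rewrite -[leRHS]gtr0_norm// -sqrtr_sqr ler_wsqrtr//.
have sq (x : R) : `|x| <= complex.Re e / 2 -> x ^+ 2 <= (complex.Re e / 2) ^+ 2.
  by move=> xe; rewrite -[leLHS]real_normK ?num_real// ler_pXn2r// nnegrE ltW.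
have := sq _ ca; have := sq _ db.
have := sqr_ge0 (complex.Re e); rewrite !expr2; lra.
Qed.

Lemma minkowski2 (R : realType) n (u v : 'I_n -> R) :
  Num.sqrt (\sum_i (u i + v i) ^+ 2) <=
  Num.sqrt (\sum_i u i ^+ 2) + Num.sqrt (\sum_i v i ^+ 2).
Proof.
have sq0 (w : 'I_n -> R) : 0 <= \sum_i w i ^+ 2.
  by apply: sumr_ge0 => i _; exact: sqr_ge0.
set A := Num.sqrt (\sum_i u i ^+ 2); set B := Num.sqrt (\sum_i v i ^+ 2).
have A0 : 0 <= A by exact: sqrtr_ge0.
have B0 : 0 <= B by exact: sqrtr_ge0.
have A2 : A ^+ 2 = \sum_i u i ^+ 2 by rewrite sqr_sqrtr.
have B2 : B ^+ 2 = \sum_i v i ^+ 2 by rewrite sqr_sqrtr.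
have null (w : 'I_n -> R) : \sum_i w i ^+ 2 = 0 -> forall i, w i = 0.
  move=> /eqP; rewrite psumr_eq0; last by move=> i _; exact: sqr_ge0.
  move=> /allP w0 i; apply/eqP; rewrite -sqrf_eq0.
  by have := w0 i (mem_index_enum _).
have CS : \sum_i u i * v i <= A * B.
  have [A00|A1] := eqVneq A 0.
    rewrite A00 mul0r big1// => i _.
    by rewrite (null u) ?mul0r// -A2 A00 expr0n.
  have [B00|B1] := eqVneq B 0.
    rewrite B00 mulr0 big1// => i _.
    by rewrite (null v) ?mulr0// -B2 B00 expr0n.
  have AB : 0 < A * B by rewrite mulr_gt0// lt0r ?A1 ?B1.
  have : 0 <= \sum_i (B * u i - A * v i) ^+ 2 by exact: sq0.
  rewrite (eq_bigr (fun i => (B ^+ 2 * u i ^+ 2 + A ^+ 2 * v i ^+ 2)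
      - (2 * (A * B)) * (u i * v i))); last by move=> i _; ring.
  rewrite sumrB big_split/= -!mulr_sumr -A2 -B2.
  set S := \sum_i _ => h.
  rewrite -(ler_pM2l AB); lra.
rewrite -(@ler_pXn2r _ 2)// ?nnegrE ?sqrtr_ge0 ?addr_ge0// sqr_sqrtr//.
rewrite (eq_bigr (fun i => u i ^+ 2 + v i ^+ 2 + 2 * (u i * v i))); last first.
  by move=> i _; ring.
rewrite !big_split/= -mulr_sumr -A2 -B2; set S := \sum_i _ in CS *.
by rewrite [leRHS](_ : _ = A ^+ 2 + B ^+ 2 + 2 * (A * B)); [lra|ring].
Qed.

Section LtwoN.
Variables (R : realType) (k : scalar_kind) (n : nat).
Local Notation K := (scalar_field R k).

(* The library's norm on ['rV_n] is the sup norm, hence this alias. *)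
Definition ltwo : Type := 'rV[K]_n.

HB.instance Definition _ := GRing.Lmodule.on ltwo.

Definition ltwo_norm (x : ltwo) : K :=
  of_real k (Num.sqrt (\sum_(i < n) rnorm (x ord0 i) ^+ 2)).

Lemma ltwo_normD x y : ltwo_norm (x + y) <= ltwo_norm x + ltwo_norm y.
Proof.
rewrite /ltwo_norm -of_realD of_real_le; apply: le_trans (minkowski2 _ _).
rewrite ler_wsqrtr// ler_sum// => i _; rewrite mxE ler_pXn2r// ?nnegrE.
- by rewrite -(of_real_le k) of_realD !of_real_rnorm ler_normD.
- exact: rnorm_ge0.
- by rewrite addr_ge0// rnorm_ge0.
Qed.

Lemma ltwo_normZ (l : K) (x : ltwo) : ltwo_norm (l *: x) = `|l| * ltwo_norm x.
Proof.
rewrite /ltwo_norm -(@of_real_rnorm R k K^o l) -of_realM; congr of_real.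
have l0 : 0 <= rnorm (l : K^o) by exact: rnorm_ge0.
rewrite -[X in X * _](ger0_norm l0) -sqrtr_sqr -sqrtrM ?sqr_ge0// mulr_sumr.
congr Num.sqrt; apply: eq_bigr => i _; rewrite mxE -exprMn; congr (_ ^+ 2).
by apply: (can_inj (@of_realK R k)); rewrite of_realM !of_real_rnorm normrM.
Qed.

Lemma norm_le_ltwo (x : ltwo) i : `|x ord0 i| <= ltwo_norm x.
Proof.
rewrite -of_real_rnorm of_real_le -[leLHS]ger0_norm ?rnorm_ge0// -sqrtr_sqr.
by rewrite ler_wsqrtr// (bigD1 i)//= lerDl sumr_ge0// => j _; rewrite sqr_ge0.
Qed.

Lemma ltwo_norm_eq0 (x : ltwo) : ltwo_norm x = 0 -> x = 0.
Proof.
move=> x0; apply/rowP => i; rewrite mxE; apply/eqP; rewrite -normr_le0 -x0.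
exact: norm_le_ltwo.
Qed.

HB.instance Definition _ := @Lmodule_isNormed.Build K ltwo ltwo_norm
  ltwo_normD ltwo_normZ ltwo_norm_eq0.

Lemma ltwo_norm_le_sum (x : ltwo) : ltwo_norm x <= \sum_i `|x ord0 i|.
Proof.
rewrite -(eq_bigr _ (fun i _ => of_real_rnorm (x ord0 i))).
rewrite -(big_morph _ (@of_realD R k) (of_real0 R k)) of_real_le.
have r0 (i : 'I_n) : 0 <= rnorm (x ord0 i) by exact: rnorm_ge0.
rewrite -[leRHS]ger0_norm ?sumr_ge0// -sqrtr_sqr ler_wsqrtr// [leRHS]expr2.
rewrite mulr_suml; apply: ler_sum => i _; rewrite expr2 ler_wpM2l//.
by rewrite (bigD1 i)//= lerDl sumr_ge0.
Qed.

Lemma ltwo_complete (F : set_system ltwo) : ProperFilter F -> cauchy F -> cvg F.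
Proof.
move=> FF Fc.
have Fi i : cvg ((fun x : ltwo => x ord0 i : K^o) @ F).
  apply: scalar_complete; apply: cauchy_image => // x y.
  by have := norm_le_ltwo (x - y) i; rewrite !mxE.
pose l : ltwo := \row_i lim ((fun x : ltwo => x ord0 i : K^o) @ F).
suff Fl : F --> l by exact: cvgP Fl.
apply/(@cvgrPdist_le _ ltwo) => e e0.
have en0 : 0 < e / n.+1%:R by rewrite divr_gt0.
have Fe : F [set x : ltwo | forall i, `|l ord0 i - x ord0 i| <= e / n.+1%:R].
  apply: filter_forall => i; rewrite mxE.
  exact: (cvgrPdist_le _ _).1 (Fi i) _ en0.
apply: filterS Fe => x xe.
apply: le_trans (ltwo_norm_le_sum _) _.
apply: (@le_trans _ _ (\sum_(i < n) e / n.+1%:R)).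
  by apply: ler_sum => i _; have := xe i; rewrite !mxE.
rewrite sumr_const card_ord -[leLHS]mulr_natr -mulrA ler_piMr ?(ltW e0)//.
by rewrite mulrC ler_pdivrMr// mul1r ler_nat.
Qed.

HB.instance Definition _ := Uniform_isComplete.Build ltwo ltwo_complete.

End LtwoN.

Section BoundedOperators.
Variables (R : realType) (k : scalar_kind).
Local Notation K := (scalar_field R k).

Record bounded_op (X Y : completeNormedModType K) := BoundedOp {
  op_fun :> {linear X -> Y};
  op_bounded : exists M : R, forall x, rnorm (op_fun x) <= M * rnorm x }.

Definition op_norm (X Y : completeNormedModType K) (f : bounded_op X Y) : R :=
  sup [set rnorm (f x) | x in [set x | rnorm x <= 1]].

Lemma op_id_subproof (X : completeNormedModType K) :
  exists M : R, forall x : X, rnorm (idfun x) <= M * rnorm x.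
Proof. by exists 1 => x; rewrite mul1r. Qed.

Definition op_id (X : completeNormedModType K) : bounded_op X X :=
  @BoundedOp X X idfun (op_id_subproof X).

Lemma op_add_subproof (X Y : completeNormedModType K) (f g : bounded_op X Y) :
  exists M : R, forall x, rnorm ((f \+ g) x) <= M * rnorm x.
Proof.
have [M fM] := op_bounded f; have [N gN] := op_bounded g.
exists (M + N) => x; rewrite mulrDl (le_trans _ (lerD (fM x) (gN x)))//.
by rewrite -(of_real_le k) of_realD !of_real_rnorm ler_normD.
Qed.

Definition op_add (X Y : completeNormedModType K) (f g : bounded_op X Y) :
  bounded_op X Y := @BoundedOp X Y (f \+ g) (op_add_subproof f g).

Lemma op_comp_subproof (X Y Z : completeNormedModType K)
    (g : bounded_op Y Z) (f : bounded_op X Y) :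
  exists M : R, forall x, rnorm ((g \o f) x) <= M * rnorm x.
Proof.
have [M fM] := op_bounded f; have [N gN] := op_bounded g.
exists (`|N| * M) => x; rewrite -mulrA (le_trans (gN _))//.
rewrite (@le_trans _ _ (`|N| * rnorm (f x)))//.
  by rewrite ler_wpM2r ?rnorm_ge0// ler_norm.
by rewrite ler_wpM2l.
Qed.

Definition op_comp (X Y Z : completeNormedModType K)
    (g : bounded_op Y Z) (f : bounded_op X Y) : bounded_op X Z :=
  @BoundedOp X Z (g \o f) (op_comp_subproof g f).

(* The range of [f] has a basis of [m] vectors; no [m] satisfies this when the
   rank is infinite. *)
Definition has_rank (X Y : completeNormedModType K) (f : bounded_op X Y)
    (m : nat) : Prop :=
  exists v : 'I_m -> Y,
    (forall c : 'I_m -> K, \sum_i c i *: v i = 0 -> forall i, c i = 0) /\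
    range f = [set \sum_i c i *: v i | c in [set: 'I_m -> K]].

(* Sequences are indexed by the positive integers: the value at index 0 is junk
   that is never used. *)
Definition op_seq := forall X Y : completeNormedModType K, bounded_op X Y -> nat -> R.

Record is_s_number (s : op_seq) : Prop := IsSNumber {
  s_ge0 : forall X Y (f : bounded_op X Y) n, (0 < n)%N -> 0 <= s X Y f n;
  s_one : forall X Y (f : bounded_op X Y), s X Y f 1%N = op_norm f;
  s_nonincreasing : forall X Y (f : bounded_op X Y) n, (0 < n)%N ->
    s X Y f n.+1 <= s X Y f n;
  s_add : forall X Y (f g : bounded_op X Y) m n, (0 < m)%N -> (0 < n)%N ->
    s X Y (op_add f g) (m + n - 1)%N <= s X Y f m + s X Y g n;
  s_comp : forall X0 X Y Y0 (h : bounded_op X0 X) (f : bounded_op X Y)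
      (z : bounded_op Y Y0) n, (0 < n)%N ->
    s X0 Y0 (op_comp (op_comp z f) h) n <= op_norm z * s X Y f n * op_norm h;
  s_rank : forall X Y (f : bounded_op X Y) m n, has_rank f m -> (m < n)%N ->
    s X Y f n = 0;
  s_id : forall n, (0 < n)%N ->
    s (ltwo R k n) (ltwo R k n) (op_id (ltwo R k n)) n = 1 }.

Definition chi_c0 (a : nat -> R) (s : op_seq) (r : nat -> R)
    (X Y : completeNormedModType K) : set (bounded_op X Y) :=
  [set f | (a i * \sum_(1 <= j < i.+1) s X Y f j) * r i @[i --> \oo] --> (0 : R)].

End BoundedOperators.

Arguments chi_c0 [R k] a s r X Y.

Definition is_weight (R : realType) (r : nat -> R) : Prop :=
  (forall n, (0 < n)%N -> 0 < r n) /\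
  (exists M : R, forall n, (0 < n)%N -> r n <= M).

(* Main.v *)
Require Import Defs.
From mathcomp Require Import all_boot all_order all_algebra.
From mathcomp Require Import all_classical all_reals all_analysis.

Import Order.TTheory GRing.Theory Num.Theory.
Import numFieldNormedType.Exports.

Local Open Scope classical_set_scope.
Local Open Scope ring_scope.

(** Squeeze argument: the factor [a i * \sum_(1 <= j < i.+1) s X Y f j] is nonnegative, so
    multiplying it by [0 < r i <= t i] places the sequence for [r] between 0 and the sequence for
    [t], which tends to 0 by assumption. *)

Theorem lemma5p7 (R : realType) (k : scalar_kind) (a r t : nat -> R)
  (s : op_seq R k)
  (a_gt0 : forall n, (0 < n)%N -> 0 < a n)
  (a_lim : exists2 l : R, l <> 0 & n%:R * a n @[n --> \oo] --> l)
  (r_weight : is_weight r) (t_weight : is_weight t)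
  (s_num : is_s_number s)
  (r_le_t : forall n, (0 < n)%N -> r n <= t n) :
  forall X Y : completeNormedModType (scalar_field R k),
    chi_c0 a s t X Y `<=` chi_c0 a s r X Y.
Proof.
move=> X Y f; rewrite /chi_c0 /= => f_t.
(* The bounds need only hold eventually; starting at 1 avoids the junk index 0, where the hypotheses
   on [a], [r] and [t] say nothing. *)
apply: (squeeze_cvgr _ (cvg_cst 0) f_t); exists 1%N => //= i i_gt0.
have as_ge0 : 0 <= a i * \sum_(1 <= j < i.+1) s X Y f j.
  (* [big_nat] exposes [0 < j], without which [s_ge0] does not apply. *)
  rewrite mulr_ge0 ?(ltW (a_gt0 _ _))// big_nat sumr_ge0// => j /andP[j_gt0 _].
  exact: s_ge0.
by rewrite mulr_ge0 ?(ltW (r_weight.1 _ _))// ler_wpM2l// r_le_t.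
Qed.
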